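(* Assume the Axiom of Choice and let $F\colon X^*\to Y$ be a function, where $X,Y$ are nonempty sets. The following assertions are equivalent. (i) $F$ is B-preassociative and arity-wise quasi-range-idempotent. (ii) There exist a B-associative $\varepsilon$-standard operation $H\colon X^*\to X\cup\{\varepsilon\}$ and a sequence $(f_n\colon \mathrm{ran}(H_n)\to Y)_{n\geqslant 1}$ of one-to-one functions such that $F_n=f_n\circ H_n$ for every integer $n\geqslant 1$. If condition (ii) holds, then for every integer $n\geqslant 1$ we have $F_n=\delta_{F_n}\circ H_n$, $f_n=\delta_{F_n}|_{\mathrm{ran}(H_n)}$, $f_n^{-1}\in Q(\delta_{F_n})$, and we may choose $H_n=g_n\circ F_n$ for any $g_n\in Q(\delta_{F_n})$.
   Context: $X^*=\bigcup_{n\geqslant 0}X^n$ is the set of all finite strings over $X$, with concatenation written as juxtaposition; $\varepsilon$ is the empty string ($X^0=\{\varepsilon\}$), $|\mathbf{x}|$ is the length of $\mathbf{x}$, and $\mathbf{x}^n$ is the concatenation of $n$ copies of $\mathbf{x}$ (so $\mathbf{x}^0=\varepsilon$, $\varepsilon^n=\varepsilon$). For $F\colon X^*\to Y$, $F_n=F|_{X^n}$ denotes its $n$-ary part. An operation $H\colon X^*\to X\cup\{\varepsilon\}$ is $\varepsilon$-standard if $H(\mathbf{x})=\varepsilon\Leftrightarrow\mathbf{x}=\varepsilon$; it is B-associative if $H(\mathbf{x}\mathbf{y}\mathbf{z})=H(\mathbf{x}H(\mathbf{y})^{|\mathbf{y}|}\mathbf{z})$ for all $\mathbf{x},\mathbf{y},\mathbf{z}\in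 X^*$. A function $F\colon X^*\to Y$ is B-preassociative if for all $\mathbf{x},\mathbf{y},\mathbf{y}',\mathbf{z}\in X^*$ with $|\mathbf{y}|=|\mathbf{y}'|$, $F(\mathbf{y})=F(\mathbf{y}')$ implies $F(\mathbf{x}\mathbf{y}\mathbf{z})=F(\mathbf{x}\mathbf{y}'\mathbf{z})$. For $n\geqslant 1$ the diagonal section of $F_n\colon X^n\to Y$ is $\delta_{F_n}\colon X\to Y$, $\delta_{F_n}(x)=F_n(x^n)$. $F$ is arity-wise quasi-range-idempotent if $\mathrm{ran}(\delta_{F_n})=\mathrm{ran}(F_n)$ for every $n\geqslant 1$. A function $g$ is a quasi-inverse of a function $f$ if $f\circ (g|_{\mathrm{ran}(f)})=\mathrm{id}|_{\mathrm{ran}(f)}$ and $\mathrm{ran}(g|_{\mathrm{ran}(f)})=\mathrm{ran}(g)$; $Q(f)$ is the set of all quasi-inverses of $f$. Here $f_n^{-1}$ denotes the inverse of $f_n$, defined on $\mathrm{ran}(f_n)$. *)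

(* Defs.v *)
From mathcomp Require Import all_boot.
From mathcomp Require Import boolp classical_sets functions.

Set Implicit Arguments.
Unset Strict Implicit.
Unset Printing Implicit Defensive.

Local Open Scope classical_set_scope.

(* X^* is [seq X], and X \cup {epsilon} is [option X] with [None] for epsilon. *)

Definition opt_word (X : Type) (o : option X) : seq X :=
  if o is Some x then [:: x] else [::].

Definition word_exp (X : Type) (w : seq X) (n : nat) : seq X :=
  flatten (nseq n w).

Definition nary (X Y : Type) (F : seq X -> Y) (n : nat) : n.-tuple X -> Y :=
  fun t => F t.

Definition eps_standard (X : Type) (H : seq X -> option X) : Prop :=
  forall w, H w = None <-> w = [::].

Definition B_associative (X : Type) (H : seq X -> option X) : Prop :=
  forall x y z,
    H (x ++ y ++ z) = H (x ++ word_exp (opt_word (H y)) (size y) ++ z).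

Definition B_preassociative (X Y : Type) (F : seq X -> Y) : Prop :=
  forall x y y' z, size y = size y' -> F y = F y' ->
    F (x ++ y ++ z) = F (x ++ y' ++ z).

Definition diag (X Y : Type) (F : seq X -> Y) (n : nat) : X -> Y :=
  fun x => nary F [tuple of nseq n x].

Definition arity_wise_quasi_range_idempotent (X Y : Type) (F : seq X -> Y) :
    Prop :=
  forall n, (0 < n)%N -> range (diag F n) = range (@nary X Y F n).

(* Here g may have any domain D on which the composition
   makes sense, i.e. one containing ran(f); its values then lie in dom(f),
   because ran(g) is the range of g restricted to ran(f). *)
Definition quasi_inverse (A B : Type) (f : A -> B) (D : set B) (g : D -> A) :
    Prop :=
  [/\ range f `<=` D,
      forall y : D, range f (set_val y) -> f (g y) = set_val y
    & g @` [set y : D | range f (set_val y)] = range g].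

(* Picks a preimage; it is the inverse of f when f is one-to-one. *)
Definition range_inv (A B : Type) (f : A -> B) (y : range f) : A :=
  s2val (cid2 (set_mem (valP y))).
Arguments range_inv {A B} f y.

(* ran(H_n) seen as a subset of X: when H is epsilon-standard, H_n does
   not take the value epsilon for n >= 1, and this set is empty for n = 0. *)
Definition op_range (X : Type) (H : seq X -> option X) (n : nat) : set X :=
  [set x | range (@nary X (option X) H n) (Some x)].

(* F_n = f o H_n, for a function f defined on the subset D of X *)
Definition fun_is_comp (X Y : Type) (F : seq X -> Y) (n : nat)
    (D : set X) (f : D -> Y) (H : seq X -> option X) : Prop :=
  forall t : n.-tuple X,
    exists2 x : D, nary H t = Some (set_val x) & nary F t = f x.

(* H_n = g o F_n, for a function g defined on the subset D of Y *)
Definition op_is_comp (X Y : Type) (H : seq X -> option X) (n : nat)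
    (D : set Y) (g : D -> X) (F : seq X -> Y) : Prop :=
  forall t : n.-tuple X,
    exists2 y : D, nary F t = set_val y & nary H t = Some (g y).

Definition B_factorization (X Y : Type) (F : seq X -> Y)
    (H : seq X -> option X) (f : forall n, op_range H n -> Y) : Prop :=
  [/\ B_associative H, eps_standard H
    & forall n, (0 < n)%N -> injective (f n) /\ fun_is_comp F n (f n) H].
Arguments B_factorization {X Y} F H f.

(* Main.v *)
Require Import Defs.
From mathcomp Require Import all_boot.
From mathcomp Require Import boolp classical_sets functions.

Local Open Scope classical_set_scope.

(** B-associativity with empty outer words reads H(y) = H(H(y)^|y|): each H_n
    sends the constant word on any of its values a back to a
    ([B_associative_diag]). So if F_n = f_n o H_n, evaluating F on constant words
    reads off f_n, and f_n is the restriction of the diagonal section of F_n to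
    ran(H_n) ([factor_is_diag]). Hence F_n = diag F_n o H_n, which gives
    quasi-range-idempotence, and the inverse of f_n is a right inverse of
    diag F_n. B-preassociativity holds because, f_n being one-to-one, words of
    equal length with equal values under F also have equal values under H, and
    H sees a factor y of a word only through H(y) and |y|.

    Conversely, let G_n choose a diagonal preimage of every value of F_n, and put
    H_n = G_n o F_n ([section_op]). Then y and H(y)^|y| have the same length and
    the same value under F, so B-preassociativity allows exchanging them inside
    any word without changing F, and hence without changing H. The diagonal
    section is one-to-one on ran(H_n), since G_n recovers the argument from its
    value; it therefore serves as f_n ([section_op_factorization]). Such sections
    G_n come from arbitrary quasi-inverses, and one quasi-inverse always exists
    by choice. *)

(** * Words and constant words *)

Lemma word_exp_letter (X : Type) (a : X) n : word_exp [:: a] n = nseq n a.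
Proof. by elim: n => //= n; rewrite /word_exp /= => ->. Qed.

Lemma eps_standard_Some (X : Type) (H : seq X -> option X) w :
  eps_standard H -> (0 < size w)%N -> exists a, H w = Some a.
Proof.
move=> Heps; case Hw: (H w) => [a|]; first by exists a.
by move/Heps: Hw => ->.
Qed.

Lemma B_associative_diag (X : Type) (H : seq X -> option X) w a :
  B_associative H -> H w = Some a -> H (nseq (size w) a) = Some a.
Proof.
move=> Hass Hw; have := Hass [::] w [::].
by rewrite !cat0s !cats0 Hw /= word_exp_letter => <-.
Qed.

(** * Consequences of a factorization *)

Section Factorization.
Context {X Y : Type} {F : seq X -> Y} {H : seq X -> option X}
  {f : forall n, op_range H n -> Y}.
Hypothesis fact : B_factorization F H f.

(** Both the word and the constant word on its H-value a have H-value a, and F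
    depends only on that value. *)
Lemma factor_diag_value n (t : n.-tuple X) (a : X) :
  (0 < n)%N -> H t = Some a -> F t = diag F n a.
Proof.
move=> n_gt0 Ht; case: fact => Hass _ /(_ n n_gt0) [_ fcomp].
have Hc : nary H [tuple of nseq n a] = Some a.
  by have := B_associative_diag _ _ _ _ Hass Ht; rewrite size_tuple.
have [x Hx Fx] := fcomp t.
have [x' Hx' Fx'] := fcomp [tuple of nseq n a].
have xx' : x = x'.
  apply: val_inj; apply: Some_inj; rewrite -[LHS]Hx -[RHS]Hx'.
  by rewrite Hc /nary Ht.
by rewrite /diag Fx' -xx' -Fx.
Qed.

Lemma factor_comp_diag n : (0 < n)%N ->
  fun_is_comp F n (fun x : [set: X] => diag F n (set_val x)) H.
Proof.
move=> n_gt0 t; case: (fact) => _ Heps _.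
have [|a Ha] := eps_standard_Some _ _ t Heps; first by rewrite size_tuple.
have aT : a \in [set: X] by rewrite in_setE.
by exists (SigSub aT) => //; apply: factor_diag_value.
Qed.

Lemma factor_is_diag n (x : op_range H n) :
  (0 < n)%N -> f n x = diag F n (set_val x).
Proof.
move=> n_gt0; have [t _ Ht] := set_mem (valP x).
case: (fact) => _ _ /(_ n n_gt0) [_ /(_ t) [x' Hx' Fx']].
have -> : x = x'.
  by apply: val_inj; apply: Some_inj; rewrite -[LHS]Ht -[RHS]Hx'.
by rewrite -Fx'; apply: factor_diag_value.
Qed.

Lemma factor_inv_quasi_inverse n : (0 < n)%N ->
  quasi_inverse (diag F n)
    (fun y : range (f n) => set_val (range_inv (f n) y)).
Proof.
move=> n_gt0.
have invK (y : range (f n)) : diag F n (set_val (range_inv (f n) y)) = set_val y.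
  by rewrite -factor_is_diag // /range_inv; case: cid2.
split.
- move=> _ [a _ <-]; case: (fact) => _ _ /(_ n n_gt0) [_ fcomp].
  by have [x _ Fx] := fcomp [tuple of nseq n a]; exists x.
- by move=> y _; apply: invK.
- apply/seteqP; split=> [_ [y _ <-]|_ [y _ <-]]; exists y => //=.
  by exists (set_val (range_inv (f n) y)); last exact: invK.
Qed.

Lemma factor_B_preassociative : B_preassociative F.
Proof.
move=> x y y' z eq_sz eqF.
have [y0|y_gt0] := posnP (size y).
  by move: eq_sz; rewrite y0 => /esym/size0nil ->; rewrite (size0nil y0).
case: (fact) => Hass Heps ffact.
(* The injectivity of f n lifts equality of F-values to the H-values. *)
have eqH : H y = H y'.
  have [finj fcomp] := ffact _ y_gt0.
  have [u Hu Fu] := fcomp (in_tuple y).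
  have [u' Hu' Fu'] := fcomp (tcast (esym eq_sz) (in_tuple y')).
  move: Hu Fu Hu' Fu'; rewrite /nary val_tcast /= => Hu Fu Hu' Fu'.
  by rewrite Hu Hu' (finj u u') // -Fu -Fu'.
have eqHxyz : H (x ++ y ++ z) = H (x ++ y' ++ z).
  by rewrite Hass eqH eq_sz -Hass.
have eq_szxyz : size (x ++ y ++ z) = size (x ++ y' ++ z).
  by rewrite !size_cat eq_sz.
have N_gt0 : (0 < size (x ++ y ++ z))%N.
  by rewrite !size_cat addnCA ltn_addr.
have [a Ha] := eps_standard_Some _ _ _ Heps N_gt0.
have := factor_diag_value _ (in_tuple (x ++ y ++ z)) a N_gt0 Ha.
have := factor_diag_value _ (tcast (esym eq_szxyz) (in_tuple (x ++ y' ++ z))) a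
  N_gt0.
by rewrite val_tcast /= -eqHxyz => /(_ Ha) -> ->.
Qed.

Lemma factor_quasi_range_idempotent : arity_wise_quasi_range_idempotent F.
Proof.
move=> n n_gt0; apply/seteqP; split=> [_ [a _ <-]|_ [t _ <-]].
  by exists [tuple of nseq n a].
have [x _ ->] := factor_comp_diag n n_gt0 t.
by exists (set_val x).
Qed.

End Factorization.

(** * Factorizations from sections of the diagonals *)

Definition section_op (X Y : Type) (F : seq X -> Y) (G : nat -> Y -> X)
    (w : seq X) : option X :=
  if w is [::] then None else Some (G (size w) (F w)).

Lemma section_opE (X Y : Type) (F : seq X -> Y) (G : nat -> Y -> X) w :
  (0 < size w)%N -> section_op X Y F G w = Some (G (size w) (F w)).
Proof. by case: w. Qed.

Lemma section_op_factorization (X Y : Type) (F : seq X -> Y)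
    (G : nat -> Y -> X) :
  B_preassociative F ->
  (forall n (t : n.-tuple X), (0 < n)%N -> diag F n (G n (F t)) = F t) ->
  B_factorization F (section_op X Y F G)
    (fun n (x : op_range (section_op X Y F G) n) => diag F n (set_val x)).
Proof.
move=> Fpre GK; set H := section_op X Y F G.
have HE n (t : n.-tuple X) : (0 < n)%N -> nary H t = Some (G n (F t)).
  by move=> n_gt0; rewrite /nary /H section_opE size_tuple.
split.
- move=> x y z; have [y0|y_gt0] := posnP (size y).
    by rewrite y0 (size0nil y0).
  have -> : H y = Some (G (size y) (F y)) by rewrite /H section_opE.
  rewrite word_exp_letter; set a := G _ _.
  have eqF : F (x ++ y ++ z) = F (x ++ nseq (size y) a ++ z).
    apply: Fpre; first by rewrite size_nseq.
    by have := GK _ (in_tuple y) y_gt0; rewrite /diag /nary /= => ->.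
  have eq_sz : size (x ++ nseq (size y) a ++ z) = size (x ++ y ++ z).
    by rewrite !size_cat size_nseq.
  have N_gt0 : (0 < size (x ++ y ++ z))%N.
    by rewrite !size_cat addnCA ltn_addr.
  by rewrite /H !section_opE ?eq_sz // eqF.
- by case.
- move=> n n_gt0; split.
    move=> x x'; have [t _ Ht] := set_mem (valP x).
    have [t' _ Ht'] := set_mem (valP x').
    move: Ht Ht'; rewrite !HE // => -[Hx] [Hx'].
    rewrite -[set_val x]Hx -[set_val x']Hx' !GK // => eqF.
    by apply: val_inj; rewrite -[LHS]Hx -[RHS]Hx' eqF.
  move=> t.
  have xin : G n (F t) \in op_range H n by rewrite in_setE; exists t; rewrite ?HE.
  by exists (SigSub xin); [rewrite HE | rewrite /= GK].
Qed.

(** Quasi-range-idempotence puts every value of F_n in the range of diag F_n,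
    where a quasi-inverse is a section. *)
Lemma quasi_inverse_factorization (X Y : Type) (F : seq X -> Y)
    (D : nat -> set Y) (g : forall n, D n -> X) :
  inhabited X -> B_preassociative F -> arity_wise_quasi_range_idempotent F ->
  (forall n, (0 < n)%N -> quasi_inverse (diag F n) (g n)) ->
  exists (H : seq X -> option X) (f : forall n, op_range H n -> Y),
    B_factorization F H f /\ forall n, (0 < n)%N -> op_is_comp H n (g n) F.
Proof.
move=> [x0] Fpre Fidem gq.
(* The letter x0 is a junk value outside the domain of g n. *)
pose G n (y : Y) : X := if insub y is Some u then g n u else x0.
have GE n (u : D n) : G n (set_val u) = g n u by rewrite /G valK.
have FD n (t : n.-tuple X) : (0 < n)%N ->
    exists2 u : D n, F t = set_val u & range (diag F n) (set_val u).
  move=> n_gt0; have [sub _ _] := gq n n_gt0.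
  have Ft : range (diag F n) (F t) by rewrite Fidem //; exists t.
  by exists (SigSub (mem_set (sub _ Ft))).
exists (section_op X Y F G), (fun n x => diag F n (set_val x)); split.
  apply: section_op_factorization => // n t n_gt0.
  have [u -> ru] := FD n t n_gt0; rewrite GE.
  by have [_ gK _] := gq n n_gt0; apply: gK.
move=> n n_gt0 t; have [u Fu _] := FD n t n_gt0; exists u => //.
by rewrite /nary section_opE size_tuple // Fu GE.
Qed.

Lemma range_inv_quasi_inverse (A B : Type) (f : A -> B) :
  quasi_inverse f (range_inv f).
Proof.
split=> // [y _|]; first by rewrite /range_inv; case: cid2.
apply/seteqP; split=> _ [y _ <-]; exists y => //=.
exact: set_mem (valP y).
Qed.

(** * The characterization *)

Theorem theorem4p11 (X Y : Type) (hX : inhabited X) (hY : inhabited Y)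
    (F : seq X -> Y) :
  [/\ (B_preassociative F /\ arity_wise_quasi_range_idempotent F) <->
        (exists (H : seq X -> option X) (f : forall n, op_range H n -> Y),
            B_factorization F H f),
      forall (H : seq X -> option X) (f : forall n, op_range H n -> Y),
        B_factorization F H f ->
        forall n, (0 < n)%N ->
          [/\ fun_is_comp F n (fun x : [set: X] => diag F n (set_val x)) H,
              forall x : op_range H n, f n x = diag F n (set_val x)
            & quasi_inverse (diag F n)
                (fun y : range (f n) => set_val (range_inv (f n) y))]
    & (exists (H : seq X -> option X) (f : forall n, op_range H n -> Y),
          B_factorization F H f) ->
      forall (D : nat -> set Y) (g : forall n, D n -> X),
        (forall n, (0 < n)%N -> quasi_inverse (diag F n) (g n)) ->
        exists (H : seq X -> option X) (f : forall n, op_range H n -> Y),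
          B_factorization F H f /\
          forall n, (0 < n)%N -> op_is_comp H n (g n) F].
Proof.
split.
- split=> [[Fpre Fidem]|[H [f fact]]].
    have [|H [f [fact _]]] := quasi_inverse_factorization X Y F
      (fun n => range (diag F n)) (fun n => range_inv (diag F n)) hX Fpre Fidem.
      by move=> n _; apply: range_inv_quasi_inverse.
    by exists H, f.
  split; first exact: factor_B_preassociative fact.
  exact: factor_quasi_range_idempotent fact.
- move=> H f fact n n_gt0; split.
  + exact: (factor_comp_diag fact).
  + by move=> x; apply: (factor_is_diag fact).
  + exact: (factor_inv_quasi_inverse fact).
- move=> [H [f fact]] D g; apply: quasi_inverse_factorization => //.
    exact: factor_B_preassociative fact.
  exact: factor_quasi_range_idempotent fact.
Qed.
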